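(* Let $\Omega$ be a non-void open subset of $\mathbb{C}^n$, $n\geqslant 1$, and let $m\geqslant 2$ be an integer. For every $(m-1)$-Baire class function $g:\Omega\to\mathbb{R}$ with respect to the pluri-fine topology $\tau$ on $\Omega$, there is a function $f:\Omega^m\to\mathbb{R}$ which is separately continuous with respect to the pluri-fine topology $\tau_m$ on $\Omega^m$ and such that $g=f\circ d_m$, where $d_m:\Omega\to\Omega^m$, $d_m(x)=(x,\dots,x)$, is the diagonal mapping.
   Context: Plurisubharmonic functions: for a non-void open set $U\subseteq\mathbb{C}^N$, $N\geqslant 1$ (with $\mathbb{C}^N$, $\mathbb{C}$, $[-\infty,\infty)$ carrying the Euclidean topologies), a function $u:U\to[-\infty,\infty)$ is plurisubharmonic (psh) if $u$ is upper semicontinuous and, for all $a,b\in\mathbb{C}^N$, the function $z\mapsto u(a+bz)$ is subharmonic or identically $-\infty$ on every connected component of $\{z\in\mathbb{C}: a+bz\in U\}$. Pluri-fine topology: the pluri-fine topology on $U$ is the coarsest topology on $U$ in which all psh functions $u:U\to[-\infty,\infty)$ are continuous. $\tau$ denotes the pluri-fine topology on $\Omega$. $\Omega^m$ is identified with the corresponding open subset of $\mathbb{C}^{mn}$, and $\tau_m$ denotes the pluri-fine topology on $\Omega^m$ (not the product topology). Baire classes: for topological spaces $X,Y$, a function $f:X\to Y$ is a first Baire class (1-Baire class) function if it is the pointwise limit on $X$ of a sequence of continuous functions $f_k:X\to Y$. For an integer $k\geqslant 2$, $f:X\to Y$ is a $k$-Baire class function if it is the pointwise limit of a sequence of functions $X\to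 Y$ each of which is in a Baire class less than $k$. $\mathbb{R}$ has the Euclidean topology. Separate continuity: let $\mu$ be a topology on a product $X=\prod_{i=1}^m X_i$ of non-void sets, $m\geqslant 2$, and $Y$ a topological space. A function $f:X\to Y$ is separately continuous (with respect to $\mu$) if, for each $(x_1,\dots,x_m)\in X$, the restriction of $f$ to each of the sets $\{(x,x_2,\dots,x_m):x\in X_1\}$, $\{(x_1,x,x_3,\dots,x_m):x\in X_2\}$, ..., $\{(x_1,\dots,x_{m-1},x):x\in X_m\}$ is continuous in the subspace topology generated by $\mu$. *)

(* Defs.v *)
From HB Require Import structures.
From mathcomp Require Import all_boot all_order all_algebra.
From mathcomp Require Import all_classical all_reals all_analysis.
From mathcomp Require Import complex.

Set Implicit Arguments.
Unset Strict Implicit.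
Unset Printing Implicit Defensive.

Import Order.TTheory GRing.Theory Num.Theory.
Import numFieldNormedType.Exports.
Local Open Scope classical_set_scope.
Local Open Scope ring_scope.
Local Open Scope complex_scope.

(* R[i] carries the topology of its modulus; matrices over R[i] then inherit
   the product topology, i.e. the Euclidean topology of C^N. *)
HB.instance Definition _ (R : realType) :=
  PseudoPointedMetric.copy R[i] R[i]^o.

Section Plurisubharmonic.
Context {R : realType}.

Definition usc_on (X : topologicalType) (U : set X) (u : X -> \bar R) : Prop :=
  forall x (c : R), U x -> (u x < c%:E)%E ->
    \forall y \near within U (nbhs x), (u y < c%:E)%E.

Definition circle_mean (u : R[i] -> \bar R) (a : R[i]) (r : R) : \bar R :=
  (((2 * pi)^-1)%:E * \int[lebesgue_measure]_(t in `[0%R, (2 * pi)%R])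
     u (a + r%:C * (cos t +i* sin t))%R)%E.

(* The following predicates take functions on the whole space but only depend
   on their values on the open set under consideration.  The last clause says
   that a subharmonic function is not identically -oo on any connected
   component of its domain.  The circle mean may be -oo. *)
Definition subharmonic (V : set R[i]) (u : R[i] -> \bar R) : Prop :=
  [/\ forall z, V z -> (u z < +oo)%E,
      usc_on V u,
      forall (a : R[i]) (r : R), 0 < r ->
        [set z | `|z - a| <= r%:C] `<=` V -> (u a <= circle_mean u a r)%E
    & forall z, V z ->
        exists2 w, connected_component V z w & u w != -oo%E].

(* C^N is represented by 'M[R[i]]_(p, q) with N = p * q: this covers both
   C^n = 'rV_n and (C^n)^m = 'M_(m, n), the latter seen as m rows in C^n. *)
Definition psh p q (U : set 'M[R[i]]_(p, q)) (u : 'M[R[i]]_(p, q) -> \bar R) :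
    Prop :=
  [/\ forall x, U x -> (u x < +oo)%E,
      usc_on U u
    & forall (a b : 'M[R[i]]_(p, q)) (z0 : R[i]),
        let V := [set z : R[i] | U (a + z *: b)] in
        let W := connected_component V z0 in
        V z0 ->
        subharmonic W (fun z => u (a + z *: b)) \/
        (forall z, W z -> u (a + z *: b) = -oo%E)].

End Plurisubharmonic.

(* The points of U with the coarsest topology for which all psh functions on U
   are continuous; continuity into \bar R is the same as continuity into its
   subspace [-oo, +oo[. *)
Definition plurifine (R : realType) p q (U : set 'M[R[i]]_(p, q)) : Type :=
  sup_topology (fun u : {u : 'M[R[i]]_(p, q) -> \bar R | psh U u} =>
    Topological.class
      (initial_topology (fun x : set_type U => sval u (val x)))).

HB.instance Definition _ (R : realType) p q (U : set 'M[R[i]]_(p, q)) :=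
  Topological.on (plurifine U).

(* There is no class 0: continuous functions belong to class 1. *)
Inductive baire_class (X Y : topologicalType) : nat -> (X -> Y) -> Prop :=
| baire_class_first (f : X -> Y) (fk : nat -> X -> Y) :
    (forall k, continuous (fk k)) ->
    (forall x, fk k x @[k --> \oo] --> f x) ->
    baire_class 1 f
| baire_class_next (j : nat) (f : X -> Y) (fk : nat -> X -> Y)
      (c : nat -> nat) :
    (2 <= j)%N ->
    (forall k, (c k < j)%N) ->
    (forall k, baire_class (c k) (fk k)) ->
    (forall x, fk k x @[k --> \oo] --> f x) ->
    baire_class j f.

(* X is a product of m factors carrying an arbitrary topology, given through
   its coordinate maps pr i. *)
Definition separately_continuous (X Y : topologicalType) (m : nat) (A : Type)
    (pr : 'I_m -> X -> A) (f : X -> Y) : Prop :=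
  forall (x : X) (i : 'I_m),
    {within [set y : X | forall j, j != i -> pr j y = pr j x], continuous f}.

Section Power.
Context {R : realType} {n : nat} (m : nat) (Omega : set 'rV[R[i]]_n).

Definition setpow : set 'M[R[i]]_(m, n) :=
  [set M | forall i : 'I_m, Omega (row i M)].

Definition pow_coord (i : 'I_m) (y : plurifine setpow) : 'rV[R[i]]_n :=
  row i (val (y : set_type setpow)).

Lemma diag_subproof (x : set_type Omega) :
  (\matrix_(i < m) val x) \in setpow.
Proof. by apply: mem_set => i; rewrite rowK; exact: set_valP. Qed.

Definition diag_map (x : plurifine Omega) : plurifine setpow :=
  exist _ (\matrix_(i < m) val (x : set_type Omega)) (diag_subproof x).

End Power.

Arguments setpow {R n} m Omega _.
Arguments pow_coord {R n} m Omega i y.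
Arguments diag_map {R n} m Omega x.

(* Main.v *)
Require Import Defs.
From mathcomp Require Import all_boot all_order all_algebra.
From mathcomp Require Import all_classical all_reals all_analysis.
From mathcomp Require Import complex ring.
Set Implicit Arguments.
Unset Strict Implicit.
Unset Printing Implicit Defensive.

Import Order.TTheory GRing.Theory Num.Theory.
Import numFieldNormedType.Exports.
Local Open Scope classical_set_scope.
Local Open Scope ring_scope.
Local Open Scope complex_scope.

(** Pluripotential theory enters only through one fact: if [u] is psh on
[Omega], then [M |-> u (row i M)] is psh on [Omega ^ m] ([psh_row]), so that
each coordinate map [Omega ^ m -> Omega] is pluri-finely continuous
([row_map_continuous]).  Everything else holds for an arbitrary topological
space [X]: a function [g : X -> R] of Baire class [m - 1] is the diagonal of a
function of [m] variables in [X] which is continuous in each variable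
([baire_separate_diagonal]).

The latter goes by induction on the class.  Let [g = lim g_k], and let [f_k] be
a separately continuous function of [m] variables with diagonal [g_k].  A
function [f] of [m + 1] variables is built by running through the values
[f_k (x_1, ..., x_m)], going further in the sequence the closer
[p = (x_0, ..., x_m)] is to the diagonal.  Closeness is measured by the
deviations
  [sum_i |f_k (x_1, ..., x_m) - f_k (x_1, ..., x_0, ..., x_m)|],
where [x_0] replaces [x_i].  These are separately continuous in [p], because
[x_0] occupies a single place at a time.  If all of them vanish at [p], and one
variable of [p] is moved, the deviation of index [k] at the new point bounds
the change of [f_k]; since [f_k] is only used where that deviation is small,
[f] varies continuously there.  Where some deviation is positive, [f] is
locally a combination of finitely many [f_k], with coefficients that are
continuous in each variable.

To know that [f_k (x_1, ..., x_m)] tends to [g (x_0)] when the deviations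
vanish, one needs the vanishing to mean that the functions [f_k] do not
distinguish the [x_i] from [x_0].  No metric is at hand on [X]; instead the
induction carries a countable family of continuous functions on [X] whose
values at the coordinates determine [f], and the differences of their values
are added to the deviations. *)

(** * Blending a sequence according to a sequence of errors *)

(** The factor [n.+1] makes the cutoff vanish for large [n] as soon as the
errors stay away from [0], while a nonzero cutoff forces an error below
[n.+1^-1]. *)
Definition cutoff (R : realType) (n : nat) (e : R) : R :=
  Num.max 0 (1 - n.+1%:R * e).

(** Each step is a convex combination of the current value and of the next term
of [F], so that estimates common to the terms in use pass to the limit. *)
Fixpoint blend (R : realType) (F E : nat -> R) (n : nat) : R :=
  if n is k.+1 then
    blend F E k + cutoff k (E k) * (F k.+1 - blend F E k)
  else F 0%N.

Lemma cutoff_ge0 (R : realType) n (e : R) : 0 <= cutoff n e.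
Proof. by rewrite /cutoff le_max lexx. Qed.

Lemma cutoff_le1 (R : realType) n (e : R) : 0 <= e -> cutoff n e <= 1.
Proof. by move=> e0; rewrite /cutoff ge_max ler01 gerBl mulr_ge0. Qed.

Lemma cutoff_eq0 (R : realType) n (e : R) : 1 <= n.+1%:R * e -> cutoff n e = 0.
Proof. by move=> h; apply/max_idPl; rewrite subr_le0. Qed.

Lemma blend_error0 (R : realType) (F E : nat -> R) :
  (forall k, E k = 0) -> forall n, blend F E n = F n.
Proof.
move=> E0; elim=> //= n ->.
by rewrite E0 /cutoff mulr0 subr0 max_r ?ler01// mul1r addrC subrK.
Qed.

Lemma blend_stationary (R : realType) (F E : nat -> R) (N : nat) :
  (forall k, (N <= k)%N -> 1 <= k.+1%:R * E k) ->
  forall n, (N <= n)%N -> blend F E n = blend F E N.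
Proof.
move=> E1; elim=> [|n IH]; first by rewrite leqn0 => /eqP ->.
rewrite leq_eqVlt => /orP[/eqP <- //|]; rewrite ltnS => Nn /=.
by rewrite cutoff_eq0 ?E1// mul0r addr0 IH.
Qed.

(** A term enters the combination only if its cutoff is nonzero, that is if the
error is small; hence closeness to [l] is required of those terms alone. *)
Lemma blend_near (R : realType) (F E : nat -> R) (K : nat) (l e : R) :
  (forall k, 0 <= E k) ->
  `|blend F E K - l| <= e ->
  (forall k, (K <= k)%N -> k.+1%:R * E k < 1 -> `|F k.+1 - l| <= e) ->
  forall n, (K <= n)%N -> `|blend F E n - l| <= e.
Proof.
move=> E0 Ke Fe; elim=> [|n IH].
  by rewrite leqn0 => /eqP K0; rewrite -{1}K0.
rewrite leq_eqVlt => /orP[/eqP <- //|]; rewrite ltnS => Kn /=.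
have {}IH := IH Kn.
have [E1|E1] := lerP 1 (n.+1%:R * E n).
  by rewrite cutoff_eq0// mul0r addr0.
have {}Fe := Fe _ Kn E1.
have t0 := @cutoff_ge0 R n (E n); have t1 := @cutoff_le1 R n _ (E0 n).
set t := cutoff _ _ in t0 t1 *; set s := blend _ _ _ in IH *.
have -> : s + t * (F n.+1 - s) - l = (1 - t) * (s - l) + t * (F n.+1 - l).
  by ring.
apply: (le_trans (ler_normD _ _)).
rewrite !normrM (ger0_norm t0) (ger0_norm (_ : 0 <= 1 - t)) ?subr_ge0//.
have -> : e = (1 - t) * e + t * e by ring.
by apply: lerD; apply: ler_wpM2l => //; rewrite subr_ge0.
Qed.

Lemma natr_mul_ge1 (R : realType) (c : R) :
  0 < c -> exists N : nat, forall k, (N <= k)%N -> 1 <= k.+1%:R * c.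
Proof.
move=> c0; exists (Num.truncn c^-1) => k Nk.
rewrite -ler_pdivrMr// div1r ltW//.
by apply: (lt_le_trans (truncnS_gt _)); rewrite ler_nat ltnS.
Qed.

Lemma blend_is_cvg (R : realType) (F E : nat -> R) :
  (forall k, 0 <= E k) -> {homo E : a b / (a <= b)%N >-> a <= b} ->
  ((forall k, E k = 0) -> cvgn F) -> cvgn (blend F E).
Proof.
move=> E0 Emono Fcvg; have [Ez|] := pselect (forall k, E k = 0).
  by rewrite (_ : blend F E = F); [exact: Fcvg|apply/funext/blend_error0].
move=> /existsNP[j /eqP Ej].
have {}Ej : 0 < E j by rewrite lt_neqAle eq_sym Ej E0.
have [N hN] := natr_mul_ge1 Ej.
apply/cvg_ex; exists (blend F E (maxn N j)).
apply: cvg_near_cst; exists (maxn N j) => // n /= Nn.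
apply/blend_stationary => // k; rewrite geq_max => /andP[Nk jk].
by apply: (le_trans (hN k Nk)); apply: ler_wpM2l => //; exact: Emono.
Qed.

Lemma blend_continuous (R : realType) (T : topologicalType)
    (F E : nat -> T -> R) (x : T) :
  (forall k, {for x, continuous (F k)}) ->
  (forall k, {for x, continuous (E k)}) ->
  forall n, {for x, continuous (fun y => blend (F^~ y) (E^~ y) n)}.
Proof.
move=> Fc Ec; elim=> [|n IH] /=; first exact: Fc.
apply: cvgD; first exact: IH.
apply: cvgM; last by apply: cvgB; [exact: Fc|exact: IH].
apply: (@continuous_max R T (cst 0) (fun y => 1 - n.+1%:R * E n y) x).
  exact: cvg_cst.
by apply: cvgB; [exact: cvg_cst|apply: cvgM; [exact: cvg_cst|exact: Ec]].
Qed.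

(** At a point where some error is positive, the sequence [blend] is stationary
from an index which is uniform nearby.  At a point [x] where all errors vanish,
[blend] coincides with [F]; nearby, the terms of [F] that come in late have an
error bounding their distance to the corresponding term at [x], whereas the
early ones are handled by continuity of a single [blend K]. *)
Lemma lim_blend_continuous (R : realType) (T : topologicalType)
    (F E : nat -> T -> R) (x : T) :
  (forall k, {for x, continuous (F k)}) ->
  (forall k, {for x, continuous (E k)}) ->
  (forall k y, 0 <= E k y) ->
  (forall y, {homo E^~ y : a b / (a <= b)%N >-> a <= b}) ->
  (forall y, (forall k, E k y = 0) -> cvgn (F^~ y)) ->
  ((forall k, E k x = 0) ->
    forall k y, `|F k.+1 y - F k.+1 x| <= E k y) ->
  {for x, continuous (fun y => limn (blend (F^~ y) (E^~ y)))}.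
Proof.
move=> Fc Ec E0 Emono Fcvg EF.
have Bcvg y : cvgn (blend (F^~ y) (E^~ y)).
  by apply: blend_is_cvg => //; exact: Fcvg.
have Bc := blend_continuous Fc Ec.
have [Ez|] := pselect (forall k, E k x = 0); last first.
  move=> /existsNP[j /eqP Ej].
  have {}Ej : 0 < E j x by rewrite lt_neqAle eq_sym Ej E0.
  have [N hN] := natr_mul_ge1 (divr_gt0 Ej (ltr0Sn R 1)).
  have stat y : E j x / 2 < E j y ->
      limn (blend (F^~ y) (E^~ y)) = blend (F^~ y) (E^~ y) (maxn N j).
    move=> jy; apply: lim_near_cst => //; exists (maxn N j) => // n /= Nn.
    apply/blend_stationary => // k; rewrite geq_max => /andP[Nk jk].
    apply: (le_trans (hN k Nk)); apply: ler_wpM2l => //.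
    by apply: (le_trans (ltW jy)); exact: Emono.
  rewrite /prop_for /continuous_at /= stat ?ltr_pdivrMr ?ltr_pMr ?ltr1n//.
  apply: cvg_trans (Bc (maxn N j)); apply: near_eq_cvg.
  have : \forall y \near x, E j x / 2 < E j y.
    by apply: (cvgr_gt (E j x) (Ec j)); rewrite ltr_pdivrMr ?ltr_pMr ?ltr1n.
  by apply: filterS => y /stat ->.
pose l := limn (F^~ x).
have Fl : F n x @[n --> \oo] --> l by exact: Fcvg.
have Bx : blend (F^~ x) (E^~ x) = F^~ x by apply/funext/blend_error0.
rewrite /prop_for /continuous_at /= Bx -/l; apply/cvgrPdist_le => e e0.
have e20 : 0 < e / 2 by rewrite divr_gt0.
have /cvgrPdist_le /(_ _ e20)[N1 _ hN1] := Fl.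
have [N2 hN2] := natr_mul_ge1 e20.
pose K := maxn N1 N2.
have Kl k : (K <= k)%N -> `|l - F k x| <= e / 2.
  by rewrite geq_max => /andP[/hN1].
have /cvgrPdist_le /(_ _ e20) := Bc K; rewrite Bx.
apply: filterS => y By.
have Bn n : (K <= n)%N -> `|l - blend (F^~ y) (E^~ y) n| <= e.
  rewrite distrC => Kn; apply: (@blend_near _ _ _ K) => //.
    rewrite -(subrKA (F K x)) (le_trans (ler_normD _ _))// (splitr e) lerD//.
      by rewrite distrC.
    by rewrite distrC; exact: Kl.
  move=> k Kk Ek; rewrite -(subrKA (F k.+1 x)).
  apply: (le_trans (ler_normD _ _)); rewrite (splitr e) lerD//; last first.
    by rewrite distrC; apply: Kl; exact: leqW.
  apply: (le_trans (EF Ez k y)).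
  rewrite -(@ler_pM2l _ k.+1%:R)// (le_trans (ltW Ek))// hN2//.
  by apply: leq_trans Kk; exact: leq_maxr.
have dcvg : `|l - blend (F^~ y) (E^~ y) n| @[n --> \oo]
    --> `|l - limn (blend (F^~ y) (E^~ y))|.
  by apply: cvg_norm; apply: cvgB; [exact: cvg_cst|exact: Bcvg].
rewrite -(cvg_lim _ dcvg)//; apply: limr_le.
  by apply/cvg_ex; eexists; exact: dcvg.
by exists K => // n /= /Bn.
Qed.

(** * Functions of several variables *)

Lemma sum_continuous (R : realType) (T : topologicalType) (I : Type)
    (r : seq I) (h : I -> T -> R) :
  (forall i, continuous (h i)) -> continuous (fun y => \sum_(i <- r) h i y).
Proof.
by move=> hc; apply: continuous_big => //; exact: add_continuous.
Qed.

Definition upd (X : Type) (m : nat) (p : 'I_m -> X) (i : 'I_m) (y : X) :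
    'I_m -> X :=
  fun j => if j == i then y else p j.

(** The variable of index [ord0] is singled out as the one substituted for the
others. *)
Definition others (X : Type) (m : nat) (p : 'I_m.+1 -> X) : 'I_m -> X :=
  fun i => p (lift ord0 i).

Definition separately_continuous_fun (X Y : topologicalType) (m : nat)
    (f : ('I_m -> X) -> Y) : Prop :=
  forall p i, continuous (fun y => f (upd p i y)).

Section Upd.
Context {X : Type} {m : nat}.
Implicit Types (p : 'I_m -> X) (q : 'I_m.+1 -> X).

Lemma upd_id p i : upd p i (p i) = p.
Proof. by apply/funext => j; rewrite /upd; case: eqVneq => [->|]. Qed.

Lemma upd_upd p i y z : upd (upd p i y) i z = upd p i z.
Proof. by apply/funext => j; rewrite /upd; case: eqVneq. Qed.

Lemma updC p i k y z : i != k -> upd (upd p i y) k z = upd (upd p k z) i y.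
Proof.
move=> ik; apply/funext => j; rewrite /upd.
by case: (eqVneq j k) => // ->; rewrite eq_sym (negPf ik).
Qed.

Lemma others_upd0 q y : others (upd q ord0 y) = others q.
Proof. by apply/funext. Qed.

Lemma others_upd_lift q i y :
  others (upd q (lift ord0 i) y) = upd (others q) i y.
Proof.
by apply/funext => j; rewrite /others /upd (inj_eq (lift_inj (h := ord0))).
Qed.

End Upd.

Lemma others_continuous (X Y : topologicalType) (m : nat)
    (f : ('I_m -> X) -> Y) :
  separately_continuous_fun f ->
  separately_continuous_fun (fun q : 'I_m.+1 -> X => f (others q)).
Proof.
move=> fc q i; case: (unliftP ord0 i) => [j|] ->.
  rewrite (_ : (fun y => _) = (fun y => f (upd (others q) j y))).
    exact: fc.
  by apply/funext => y; rewrite others_upd_lift.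
rewrite (_ : (fun y => _) = cst (f (others q))); first exact: cst_continuous.
by apply/funext => y; rewrite others_upd0.
Qed.

(** Substitute for a separation axiom: points which the family [H] does not
separate are interchangeable in [f]. *)
Definition determined_by (R X : Type) (m : nat)
    (H : nat -> X -> R) (f : ('I_m -> X) -> R) : Prop :=
  forall p q, (forall k i, H k (p i) = H k (q i)) -> f p = f q.

(** The induction hypothesis on Baire classes: [g] is the diagonal of a
separately continuous function of [m] variables, determined by countably many
continuous functions of one variable. *)
Definition separate_diagonal (R : realType) (X : topologicalType) (m : nat)
    (g : X -> R) : Prop :=
  exists (H : nat -> X -> R) (f : ('I_m -> X) -> R),
    [/\ forall k, continuous (H k), separately_continuous_fun f,
        determined_by H f & forall x, f (fun=> x) = g x].

Lemma separate_diagonal_continuous (R : realType) (X : topologicalType)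
    (g : X -> R) : continuous g -> separate_diagonal 1 g.
Proof.
move=> gc; exists (fun=> g), (fun p => g (p ord0)); split => //.
- by move=> p i; rewrite (ord1 i) /upd eqxx.
- by move=> p q pq; exact: (pq 0%N).
Qed.

(** * Raising the Baire class and the number of variables *)

(** Distance from the diagonal as seen by [H k] and [f k].  The variable
[p ord0] is substituted at one place at a time, for [f k] is only continuous in
each variable separately. *)
Definition deviation (R : realType) (X : Type) (m : nat) (H : nat -> X -> R)
    (f : nat -> ('I_m -> X) -> R) (k : nat) (p : 'I_m.+1 -> X) : R :=
  \sum_(i < m) (`|H k (p (lift ord0 i)) - H k (p ord0)| +
                `|f k (others p) - f k (upd (others p) i (p ord0))|).

Lemma deviation_ge0 (R : realType) (X : Type) (m : nat) (H : nat -> X -> R)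
    (f : nat -> ('I_m -> X) -> R) (k : nat) (p : 'I_m.+1 -> X) :
  0 <= deviation H f k p.
Proof. by apply: sumr_ge0 => i _; rewrite addr_ge0. Qed.

Lemma deviation_ge_f (R : realType) (X : Type) (m : nat) (H : nat -> X -> R)
    (f : nat -> ('I_m -> X) -> R) (k : nat) (p : 'I_m.+1 -> X) (i : 'I_m) :
  `|f k (others p) - f k (upd (others p) i (p ord0))| <= deviation H f k p.
Proof.
rewrite /deviation (bigD1 i)//= addrAC lerDr addr_ge0//.
by apply: sumr_ge0 => l _; rewrite addr_ge0.
Qed.

Lemma deviation_ge_H (R : realType) (X : Type) (m : nat) (H : nat -> X -> R)
    (f : nat -> ('I_m -> X) -> R) (k : nat) (p : 'I_m.+1 -> X) (i : 'I_m) :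
  `|H k (p (lift ord0 i)) - H k (p ord0)| <= deviation H f k p.
Proof.
rewrite /deviation (bigD1 i)//= -addrA lerDl addr_ge0//.
by apply: sumr_ge0 => l _; rewrite addr_ge0.
Qed.

Lemma deviation_diag (R : realType) (X : Type) (m : nat) (H : nat -> X -> R)
    (f : nat -> ('I_m -> X) -> R) (k : nat) (x : X) :
  deviation H f k (fun=> x) = 0.
Proof.
apply: big1 => i _; rewrite (_ : upd _ _ _ = fun=> x) ?subrr ?normr0 ?addr0//.
exact: (upd_id (fun=> x)).
Qed.

Lemma deviation_continuous (R : realType) (X : topologicalType) (m : nat)
    (H : nat -> X -> R) (f : nat -> ('I_m -> X) -> R) (k : nat) :
  continuous (H k) -> separately_continuous_fun (f k) ->
  separately_continuous_fun (deviation H f k).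
Proof.
move=> Hc fc p i; rewrite /deviation.
apply: sum_continuous => l x.
have Hcoord j : continuous (fun y => H k (upd p i y j)).
  move=> y; rewrite /upd; case: eqP => _; [exact: Hc|exact: cvg_cst].
have fc1 : continuous (fun y => f k (others (upd p i y))).
  exact: others_continuous.
have fc2 : continuous
    (fun y => f k (upd (others (upd p i y)) l (upd p i y ord0))).
  case: (unliftP ord0 i) => [i'|] ->; last first.
    rewrite (_ : (fun y => _) = (fun y => f k (upd (others p) l y))).
      exact: fc.
    by apply/funext => y; rewrite others_upd0.
  have [->|il] := eqVneq i' l.
    rewrite (_ : (fun y => _) = cst (f k (upd (others p) l (p ord0)))).
      exact: cst_continuous.
    by apply/funext => y; rewrite others_upd_lift upd_upd.
  rewrite (_ : (fun y => _) =
      (fun y => f k (upd (upd (others p) l (p ord0)) i' y))); first exact: fc.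
  by apply/funext => y; rewrite others_upd_lift updC.
by apply: cvgD; apply: cvg_norm; apply: cvgB;
  [exact: Hcoord|exact: Hcoord|exact: fc1|exact: fc2].
Qed.

Lemma deviation_determined (R : realType) (X : Type) (m : nat)
    (H : nat -> X -> R) (f : nat -> ('I_m -> X) -> R) (k : nat) :
  (forall k, determined_by H (f k)) ->
  determined_by H (deviation H f k).
Proof.
move=> fH p q pq; apply: eq_bigr => i _; rewrite !pq; congr (_ + `| _ - _ |).
  by apply: fH => l j; exact: pq.
by apply: fH => l j; rewrite /upd; case: ifP => _; exact: pq.
Qed.

(** The function of [m.+1] variables is the limit of the blend of the functions
[f k], applied to all variables but one, with the partial sums of the deviations
as errors. *)
Lemma separate_diagonal_lim_fixed (R : realType) (X : topologicalType)
    (m : nat) (g : X -> R) (H : nat -> X -> R) (f : nat -> ('I_m -> X) -> R) :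
  (forall k, continuous (H k)) ->
  (forall k, separately_continuous_fun (f k)) ->
  (forall k, determined_by H (f k)) ->
  (forall x, f k (fun=> x) @[k --> \oo] --> g x) ->
  separate_diagonal m.+1 g.
Proof.
move=> Hc fc fH fg.
(* [E N] controls the next term [F N.+1], hence the bound [N.+2]. *)
pose E N (p : 'I_m.+1 -> X) := \sum_(k < N.+2) deviation H f k p.
pose F N (p : 'I_m.+1 -> X) := f N (others p).
have E0 N p : 0 <= E N p by apply: sumr_ge0 => k _; exact: deviation_ge0.
have Emono p : {homo E^~ p : a b / (a <= b)%N >-> a <= b}.
  apply/nondecreasing_seqP => N.
  by rewrite /E [leRHS]big_ord_recr/= lerDl deviation_ge0.
have Edev N k p : (k <= N.+1)%N -> deviation H f k p <= E N p.
  move=> kN; rewrite /E (bigD1 (Ordinal (kN : (k < N.+2)%N)))//= lerDl.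
  by apply: sumr_ge0 => l _; exact: deviation_ge0.
have EH p : (forall N, E N p = 0) ->
    forall k i, H k (p i) = H k (p ord0).
  move=> E0p k i; case: (unliftP ord0 i) => [{}i|] -> //.
  apply/eqP; rewrite -subr_eq0 -normr_eq0 eq_le normr_ge0 andbT -(E0p k).
  by apply: le_trans (deviation_ge_H H f k p i) _; apply: Edev.
have EF p : (forall N, E N p = 0) -> forall k, F k p = f k (fun=> p ord0).
  by move=> /EH E0p k; apply: fH => l i; exact: E0p.
exists H, (fun p => limn (blend (F^~ p) (E^~ p))); split => //.
- move=> p i x; pose q := upd p i x.
  apply: (@lim_blend_continuous R X (fun k y => F k (upd p i y))
    (fun k y => E k (upd p i y)) x).
  + by move=> k; apply: others_continuous.
  + move=> N; apply: sum_continuous => k; exact: deviation_continuous.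
  + by move=> k y; exact: E0.
  + by move=> y; exact: Emono.
  + move=> y /EF Fy; rewrite (funext Fy); apply/cvg_ex.
    by exists (g (upd p i y ord0)); exact: fg.
  (* Either the moved variable does not occur in [F], or putting the variable of
     index [ord0] back in its place yields a point that [H] does not separate
     from the original one, and the deviation bounds the effect of doing so. *)
  + move=> Eq k y; apply: le_trans (Edev k k.+1 _ (leqnn _)).
    rewrite -/q; have := EF q Eq k.+1; have {Eq} := EH q Eq.
    rewrite /F /q; case: (unliftP ord0 i) => [j|] ->; last first.
      by rewrite !others_upd0 subrr normr0 deviation_ge0.
    rewrite !others_upd_lift => Hq ->.
    apply: le_trans (deviation_ge_f H f k.+1 _ j).
    rewrite others_upd_lift upd_upd.
    rewrite (fH _ (fun=> upd p _ x ord0) (upd (others p) j (p ord0)))//.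
    move=> l r.
    have := Hq l (lift ord0 r).
    rewrite /upd /others (inj_eq (lift_inj (h := ord0))).
    by case: ifP => // _ <-.
- move=> p q pq; congr (limn (blend _ _)); apply/funext => k.
    by apply: fH => l i; exact: pq.
  by apply: eq_bigr => l _; exact: deviation_determined.
- move=> x; have Ex N : E N (fun=> x) = 0.
    by apply: big1 => k _; exact: deviation_diag.
  rewrite (_ : blend _ _ = f^~ (fun=> x)); first exact/cvg_lim/fg.
  by apply/funext => N; rewrite blend_error0.
Qed.

(** The families attached to the functions [gk k] are merged into a single one,
indexed by codes of pairs. *)
Lemma separate_diagonal_lim (R : realType) (X : topologicalType) (m : nat)
    (g : X -> R) (gk : nat -> X -> R) :
  (forall k, separate_diagonal m (gk k)) ->
  (forall x, gk k x @[k --> \oo] --> g x) -> separate_diagonal m.+1 g.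
Proof.
move=> /choice[H /choice[f Hf]] gkg.
pose H' n := if unpickle n is Some (k, j) then H k j else cst 0.
apply: (@separate_diagonal_lim_fixed R X m g H' f).
- move=> n; rewrite /H'; case: unpickle => [[k j]|]; last exact: cst_continuous.
  by have [] := Hf k.
- by move=> k; have [] := Hf k.
- move=> k p q pq; have [_ _ fH _] := Hf k; apply: fH => j i.
  by have := pq (pickle (k, j)) i; rewrite /H' pickleK.
- move=> x; rewrite (_ : (fun k => f k _) = gk^~ x)//.
  by apply/funext => k; have [] := Hf k.
Qed.

(** Adding a variable is the case of a constant sequence. *)
Lemma separate_diagonalS (R : realType) (X : topologicalType) (m : nat)
    (g : X -> R) : separate_diagonal m g -> separate_diagonal m.+1 g.
Proof.
move=> dg; apply: (@separate_diagonal_lim _ _ _ _ (fun=> g)) => // x.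
exact: cvg_cst.
Qed.

Lemma separate_diagonal_leq (R : realType) (X : topologicalType) (m k : nat)
    (g : X -> R) :
  (m <= k)%N -> separate_diagonal m g -> separate_diagonal k g.
Proof.
move=> mk dg; elim: k mk => [|k IH]; first by rewrite leqn0 => /eqP <-.
by rewrite leq_eqVlt => /orP[/eqP <- //|/IH]; exact: separate_diagonalS.
Qed.

Lemma baire_separate_diagonal (R : realType) (X : topologicalType) (j : nat)
    (g : X -> R) : baire_class j g -> separate_diagonal j.+1 g.
Proof.
elim=> {j g} [g gk gkc gkg|j g gk c j2 cj _ IH gkg].
  by apply: separate_diagonal_lim gkg => k; exact: separate_diagonal_continuous.
apply: separate_diagonal_lim gkg => k.
exact: separate_diagonal_leq (cj k) (IH k).
Qed.

(** * The coordinate maps of the pluri-fine topology *)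

Lemma row_continuous (T : topologicalType) (m n : nat) (i : 'I_m) :
  continuous (row i : 'M[T]_(m, n) -> 'rV[T]_n).
Proof.
move=> M A [P MP PA]; exists (fun k j => if k == i then P ord0 j else setT).
  move=> k j; case: eqP => [->|_]; last exact: filterT.
  by have := MP ord0 j; rewrite mxE.
move=> N NP; apply: PA => k j; rewrite (ord1 k) mxE.
by have := NP i j; rewrite eqxx.
Qed.

Lemma usc_on_comp (R : realType) (X Y : topologicalType) (U : set X)
    (V : set Y) (h : Y -> X) (u : X -> \bar R) :
  continuous h -> (forall y, V y -> U (h y)) ->
  usc_on U u -> usc_on V (u \o h).
Proof.
move=> hc VU uU y c Vy uy.
have hu : \forall z \near y, U (h z) -> (u (h z) < c%:E)%E.
  exact: hc (uU (h y) c (VU y Vy) uy).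
by rewrite near_withinE; apply: filterS hu => z zu /VU.
Qed.

(** A subharmonic function may be [-oo] on a connected subset, which the
point [w] excludes. *)
Lemma subharmonic_subset (R : realType) (V W : set R[i])
    (u : R[i] -> \bar R) (w : R[i]) :
  W `<=` V -> connected W -> W w -> u w != -oo%E ->
  subharmonic V u -> subharmonic W u.
Proof.
move=> WV Wc Ww uw [ufin uusc umean _]; split.
- by move=> z /WV; exact: ufin.
- by apply: (@usc_on_comp R _ _ V W id u) uusc => // z; exact: cvg_id.
- by move=> a r r0 aW; apply: umean => //; exact: subset_trans aW WV.
- by move=> z Wz; exists w => //; rewrite connected_component_id.
Qed.

(** A complex line in the matrices projects to a complex line of rows; a
component [W] of the trace of the former lies in a component [W'] of the trace
of the latter.  On [W] the function is either identically [-oo] or inherits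
subharmonicity from [W']. *)
Lemma psh_row (R : realType) (m n : nat) (Omega : set 'rV[R[i]]_n)
    (u : 'rV[R[i]]_n -> \bar R) (i : 'I_m) :
  psh Omega u -> psh (setpow m Omega) (fun M => u (row i M)).
Proof.
move=> [ufin uusc uline]; split.
- by move=> M /(_ i); exact: ufin.
- apply: (@usc_on_comp _ _ _ Omega _ (row i)) uusc; first exact: row_continuous.
  by move=> M; exact.
move=> a b z0 V W Vz0.
pose V' := [set z | Omega (row i a + z *: row i b)].
have rowE z : row i (a + z *: b) = row i a + z *: row i b.
  by rewrite linearD linearZ.
have VV' : V `<=` V' by move=> z /(_ i); rewrite rowE.
pose W' := connected_component V' z0.
have WW' : W `<=` W'.
  apply: connected_component_max; first exact: connected_component_refl.
    exact: subset_trans (@connected_component_sub _ _ _) VV'.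
  exact: component_connected.
have -> : (fun z => u (row i (a + z *: b))) =
          (fun z => u (row i a + z *: row i b)).
  by apply/funext => z; rewrite rowE.
have [uoo|] := pselect (forall z, W z -> u (row i a + z *: row i b) = -oo%E).
  by right => z /uoo; rewrite rowE.
move=> /existsNP[w /not_implyP[Ww /eqP uw]]; left.
have [|sub|uoo] := uline (row i a) (row i b) z0; first exact: VV'.
  by apply: (subharmonic_subset (w := w)) sub => //; exact: component_connected.
by case/eqP: uw; exact: uoo (WW' _ Ww).
Qed.

Lemma row_subproof (R : realType) (m n : nat) (Omega : set 'rV[R[i]]_n)
    (i : 'I_m) (y : set_type (setpow m Omega)) : row i (val y) \in Omega.
Proof. by apply: mem_set; exact: (set_valP y i). Qed.

Definition row_map (R : realType) (m n : nat) (Omega : set 'rV[R[i]]_n)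
    (i : 'I_m) (y : plurifine (setpow m Omega)) : plurifine Omega :=
  exist _ (row i (val (y : set_type (setpow m Omega))))
    (row_subproof i (y : set_type (setpow m Omega))).

Lemma plurifine_continuous_psh (R : realType) (p q : nat)
    (U : set 'M[R[i]]_(p, q)) (u : 'M[R[i]]_(p, q) -> \bar R) :
  psh U u -> continuous (fun x : plurifine U => u (val (x : set_type U))).
Proof.
move=> upsh x A.
move=> /(@initial_continuous (set_type U) _ (fun y => u (val y))) nA.
have /cvg_sup /(_ (exist _ u upsh)) : nbhs x --> x by [].
exact.
Qed.

Lemma row_map_continuous (R : realType) (m n : nat) (Omega : set 'rV[R[i]]_n)
    (i : 'I_m) : continuous (@row_map R m n Omega i).
Proof.
move=> y; apply/cvg_sup => [|[u upsh]].
  by apply: fmap_filter; exact: nbhs_filter.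
apply: continuous_comp_initial.
exact: plurifine_continuous_psh (psh_row i upsh).
Qed.

Unset Implicit Arguments.
Set Strict Implicit.

Theorem theorem2p3 (R : realType) (n m : nat) (hn : (1 <= n)%N) (hm : (2 <= m)%N)
    (Omega : set 'rV[R[i]]_n) (Omega_neq0 : Omega !=set0)
    (Omega_open : open Omega) (g : plurifine Omega -> R) :
  baire_class m.-1 g ->
  exists f : plurifine (setpow m Omega) -> R,
    separately_continuous (pow_coord m Omega) f /\
    g = f \o diag_map m Omega.
Proof.
case: m hm => // m _ /= /baire_separate_diagonal[H [f [_ fc _ fg]]].
exists (fun M => f (fun i => row_map i M)); split; last first.
  apply/funext => x /=; rewrite -fg; congr f; apply/funext => i.
  by apply: val_inj => /=; rewrite rowK.
move=> M i; set A := [set _ | _].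
(* On the line [A], [f] only depends on the row of index [i]. *)
apply: (@subspace_eq_continuous _ A _
  ((fun y => f (upd (fun j => row_map j M) i y)) \o row_map i)).
  move=> N /set_mem AN /=; congr f; apply/funext => j; rewrite /upd.
  by case: eqVneq => [->//|ji]; apply: val_inj; exact: esym (AN j ji).
apply: continuous_subspaceT => N; apply: continuous_comp.
  exact: row_map_continuous.
exact: fc.
Qed.
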